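(* Let $\boldsymbol\varepsilon$ be an $m$-dimensional random vector with finite second order moments, $\mathrm E\,\boldsymbol\varepsilon=\mathbf 0$ and $\mathrm{Var}\,\boldsymbol\varepsilon=\boldsymbol\Omega$. If $H_0(\mathbf u)$ holds, i.e. $\mathcal L(\boldsymbol\varepsilon)=\mathcal L(\mathbf R_{\mathbf u}\boldsymbol\varepsilon)$, then $\mathbf u^\top\boldsymbol\varepsilon$ and $\boldsymbol\Gamma_{\mathbf u}^\top\boldsymbol\varepsilon$ are uncorrelated. Moreover, if $\boldsymbol\varepsilon$ has a (multivariate) normal distribution, then $\mathbf u^\top\boldsymbol\varepsilon$ and $\boldsymbol\Gamma_{\mathbf u}^\top\boldsymbol\varepsilon$ are independent (still under $H_0(\mathbf u)$).
   Context: $m\ge2$ is an integer, $\mathbf u\in\mathbb R^m$ is a fixed vector with $\|\mathbf u\|=1$, and $\boldsymbol\Gamma_{\mathbf u}$ is any $m\times(m-1)$ matrix such that $(\mathbf u\,|\,\boldsymbol\Gamma_{\mathbf u})$ is orthogonal. $\mathbf R_{\mathbf u}=2\mathbf u\mathbf u^\top-\mathbf I$, and $\mathcal L(\boldsymbol Z)$ denotes the distribution of $\boldsymbol Z$. *)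

(* Defs.v *)
From HB Require Import structures.
From mathcomp Require Import all_boot all_order all_algebra.
From mathcomp Require Import all_classical all_reals all_analysis.
From mathcomp Require Import measurable_realfun.

Set Implicit Arguments.
Unset Strict Implicit.
Unset Printing Implicit Defensive.

Import Order.TTheory GRing.Theory Num.Theory.
Import numFieldNormedType.Exports.

Local Open Scope classical_set_scope.
Local Open Scope ring_scope.

(* Matrices carry the product sigma-algebra, i.e. the one generated by the
   entries; on ['cV[R]_n] this is the Borel sigma-algebra of R^n. *)

Definition measure_matrix_display : measure_display -> measure_display.
Proof. exact. Qed.

Section measurable_matrix.
Context {d} {T : measurableType d} (m n : nat).

Definition matrix_entry_preimages : set (set 'M[T]_(m, n)) :=
  [set C | exists (i : 'I_m) (j : 'I_n) (B : set T),
    measurable B /\ C = [set M : 'M[T]_(m, n) | B (M i j)]].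

Let matrix_set0 : <<s matrix_entry_preimages >> set0.
Proof. exact: sigma_algebra0. Qed.

Let matrix_setC A : <<s matrix_entry_preimages >> A ->
  <<s matrix_entry_preimages >> (~` A).
Proof. exact: sigma_algebraC. Qed.

Let matrix_bigcup (F : (set 'M[T]_(m, n))^nat) :
  (forall i, <<s matrix_entry_preimages >> (F i)) ->
  <<s matrix_entry_preimages >> (\bigcup_i (F i)).
Proof. exact: sigma_algebra_bigcup. Qed.

HB.instance Definition _ := @isMeasurable.Build (measure_matrix_display d)
  'M[T]_(m, n) <<s matrix_entry_preimages >>
  matrix_set0 matrix_setC matrix_bigcup.

Lemma measurable_entry (i : 'I_m) (j : 'I_n) :
  measurable_fun [set: 'M[T]_(m, n)] (fun M : 'M[T]_(m, n) => M i j).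
Proof.
by move=> _ B mB; rewrite setTI; apply: sub_sigma_algebra; exists i, j, B.
Qed.

Lemma measurable_fun_matrix d' (S : measurableType d') (f : S -> 'M[T]_(m, n)) :
  (forall i j, measurable_fun [set: S] (fun s => f s i j)) ->
  measurable_fun [set: S] f.
Proof.
move=> mf; apply: (@measurability _ _ _ _ _ _ matrix_entry_preimages) => //.
move=> _ [_ [i [j [B [mB ->]]]] <-].
exact: mf.
Qed.

End measurable_matrix.

Section measurable_mulmx.
Context {R : realType} (m n p : nat) (A : 'M[R]_(m, n)).

Lemma measurable_mulmx :
  measurable_fun [set: 'M[R]_(n, p)] (mulmx A : 'M[R]_(n, p) -> 'M[R]_(m, p)).
Proof.
apply: measurable_fun_matrix => i j.
under eq_fun do rewrite mxE.
apply: measurable_sum => k.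
by apply: measurable_funM; [exact: measurable_cst|exact: measurable_entry].
Qed.

HB.instance Definition _ := @isMeasurableFun.Build _ _ _ _
  (mulmx A : 'M[R]_(n, p) -> 'M[R]_(m, p)) measurable_mulmx.

End measurable_mulmx.

Section linear_algebra.
Context {R : realType}.

(* The library norm [`|u|] on matrices is the sup norm, hence this one. *)
Definition euclidean_norm m (u : 'cV[R]_m) : R :=
  Num.sqrt (\sum_(i < m) u i 0 ^+ 2).

(* The two equations force [m = n]; a rectangular type allows [row_mx u G] with
   [G : 'M_(m, m.-1)], whose width [1 + m.-1] is not convertible to [m]. *)
Definition orthogonal_mx m n (Q : 'M[R]_(m, n)) : Prop :=
  Q^T *m Q = 1%:M /\ Q *m Q^T = 1%:M.

Definition reflection_mx m (u : 'cV[R]_m) : 'M[R]_m :=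
  2%:R *: (u *m u^T) - 1%:M.

End linear_algebra.

Section random_vectors.
Context {R : realType} {d : measure_display} {T : measurableType d}.
Variable P : probability T R.

Definition coordinate n (X : T -> 'cV[R]_n) (i : 'I_n) : T -> R :=
  fun w => X w i 0.

Definition finite_second_moments n (X : {RV P >-> 'cV[R]_n}) : Prop :=
  forall i, coordinate X i \in Lfun P 2%:E.

Definition has_mean n (X : {RV P >-> 'cV[R]_n}) (mu : 'cV[R]_n) : Prop :=
  forall i, 'E_P[coordinate X i]%E = (mu i 0)%:E.

Definition has_cross_covariance p q (X : {RV P >-> 'cV[R]_p})
    (Y : {RV P >-> 'cV[R]_q}) (S : 'M[R]_(p, q)) : Prop :=
  forall i j, covariance P (coordinate X i) (coordinate Y j) = (S i j)%:E.

Definition has_variance n (X : {RV P >-> 'cV[R]_n}) (S : 'M[R]_n) : Prop :=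
  has_cross_covariance X X S.

Definition uncorrelated p q (X : {RV P >-> 'cV[R]_p})
    (Y : {RV P >-> 'cV[R]_q}) : Prop :=
  has_cross_covariance X Y 0.

Definition independent_RV d1 d2 (T1 : measurableType d1)
    (T2 : measurableType d2) (X : {RV P >-> T1}) (Y : {RV P >-> T2}) : Prop :=
  forall (A : set T1) (B : set T2), measurable A -> measurable B ->
    P (X @^-1` A `&` Y @^-1` B) = (P (X @^-1` A) * P (Y @^-1` B))%E.

(* Laws are compared on measurable sets only, since a probability is a total
   function whose values on other sets are meaningless. *)
Definition same_law d' (T' : measurableType d') (X Y : {RV P >-> T'}) : Prop :=
  forall B : set T', measurable B -> distribution P X B = distribution P Y B.

Definition reflection_symmetric m (u : 'cV[R]_m) (X : {RV P >-> 'cV[R]_m}) :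
    Prop :=
  same_law X (mulmx (reflection_mx u) \o X : {RV P >-> 'cV[R]_m}).

End random_vectors.

Section multivariate_normal.
Context {R : realType}.

(* The law of k independent N(0, 1) variables, characterized on boxes. *)
Definition standard_normal_law k (nu : probability 'cV[R]_k R) : Prop :=
  forall B : 'I_k -> set R, (forall i, measurable (B i)) ->
    nu [set z | forall i, B i (z i 0)] =
    (\prod_(i < k) fine (normal_prob 0 1 (B i)))%:E.

(* X is distributed as A Z + b with Z a standard normal vector of some
   dimension k; the covariance A A^T may be singular. *)
Definition normal_vector d (T : measurableType d) (P : probability T R) n
    (X : {RV P >-> 'cV[R]_n}) : Prop :=
  exists (k : nat) (nu : probability 'cV[R]_k R)
      (A : 'M[R]_(n, k)) (b : 'cV[R]_n),
    standard_normal_law nu /\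
    forall B : set 'cV[R]_n, measurable B ->
      distribution P X B = pushforward nu (fun z => A *m z + b) B.

End multivariate_normal.

(* Main.v *)
(* The reflection R_u fixes u^T eps and changes the sign of Gamma^T eps, so
   E[(u^T eps)(Gamma^T eps)_j] is its own opposite, hence 0.
   In the normal case eps ~ A Z with Z standard normal; as E[Z Z^T] is a nonzero
   multiple of the identity, the vector a = (u^T A)^T satisfies C a = 0 for
   C = Gamma^T A, and it remains to see that a^T Z and C Z are independent.
   The law of Z is invariant under rotations of a coordinate plane, because such
   a rotation is a product of three shears and so preserves the Lebesgue measure
   of the plane, as well as the density, which depends on x^2 + y^2 only. Such
   rotations bring a onto a coordinate axis; then a^T Z involves one coordinate
   of Z and C Z only the others. *)

Require Import Defs.
From mathcomp Require Import all_boot all_order all_algebra.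
From mathcomp Require Import all_classical all_reals all_analysis.
From mathcomp Require Import measurable_realfun.
From mathcomp Require Import ring lra.

Set Implicit Arguments.
Unset Strict Implicit.
Unset Printing Implicit Defensive.

Import Order.TTheory GRing.Theory Num.Theory.
Import numFieldNormedType.Exports.

Local Open Scope ring_scope.

(** * Lebesgue measure of the plane: invariance under shears and rotations *)

Section plane_lebesgue.
Context {R : realType}.
Local Open Scope classical_set_scope.
Local Notation RR := (measurableTypeR R).
Local Notation mu := (@lebesgue_measure R).
Local Notation mu2 := (mu \x mu)%E.

(** Translation keeps the length of half-open intervals, and these lengths determine Lebesgue
    measure. *)
Lemma lebesgue_measureD (t : R) (A : set RR) : measurable A ->
  mu [set x | A (x + t)] = mu A.
Proof.
pose g : RR -> RR := fun x => x + t.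
have mg : measurable_fun [set: RR] g.
  by apply: measurable_funD => //; exact: measurable_id.
move=> mA; apply/esym.
apply: (@lebesgue_measure_unique R (pushforward mu g)) => //= _ [[a b]] _ <-.
rewrite /pushforward (_ : g @^-1` _ = `]a - t, b - t]%classic); last first.
  by apply/seteqP; split => x /=; rewrite /g !in_itv/= ltrBlDr lerBrDr.
by rewrite !lebesgue_measure_itv/= !lte_fin ltrD2r -!EFinD opprB addrA subrK.
Qed.

Definition preserves_plane_lebesgue (f : RR * RR -> RR * RR) : Prop :=
  measurable_fun [set: RR * RR] f /\
  forall D, measurable D -> mu2 (f @^-1` D) = mu2 D.

Lemma preserves_plane_lebesgue_comp f g :
  preserves_plane_lebesgue f -> preserves_plane_lebesgue g ->
  preserves_plane_lebesgue (f \o g).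
Proof.
move=> [mf pf] [mg pg]; split; first exact: measurableT_comp.
move=> D mD; rewrite comp_preimage pg ?pf// -[X in measurable X]setTI.
exact: mf.
Qed.

(** The product measure is the only measure with these values on rectangles, and its pushforward by
    [f] is a measure. *)
Lemma preserves_plane_lebesgue_rect f :
    measurable_fun [set: RR * RR] f ->
    (forall A B, measurable A -> measurable B ->
      mu2 (f @^-1` (A `*` B)) = (mu A * mu B)%E) ->
  preserves_plane_lebesgue f.
Proof.
move=> mf fAB; split=> // D mD.
apply/esym.
by apply: (@product_measure_unique _ _ _ _ _ _ _ (pushforward mu2 f)).
Qed.

Lemma preserves_plane_lebesgue_swap :
  preserves_plane_lebesgue (fun z => (z.2, z.1)).
Proof.
apply: preserves_plane_lebesgue_rect => [|A B mA mB].
  by apply: measurable_fun_pair; [exact: measurable_snd|exact: measurable_fst].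
rewrite (_ : _ @^-1` _ = B `*` A); first by rewrite product_measure1E// muleC.
by apply/seteqP; split=> -[x y] [].
Qed.

(** Above each x in [A] the section of the preimage of a rectangle is a translate of [B], hence as
    long as [B]; integrating the lengths of the sections gives the area. *)
Lemma preserves_plane_lebesgue_shear (t : R) :
  preserves_plane_lebesgue (fun z => (z.1, z.2 + t * z.1)).
Proof.
have mf : measurable_fun [set: RR * RR]
    ((fun z => (z.1, z.2 + t * z.1)) : RR * RR -> RR * RR).
  apply: measurable_fun_pair; first exact: measurable_fst.
  apply: measurable_funD; first exact: measurable_snd.
  by apply: measurable_funM; [exact: measurable_cst|exact: measurable_fst].
apply: preserves_plane_lebesgue_rect => // A B mA mB.
rewrite /product_measure1 (_ : (fun x : RR => _) =
    (fun x => (mu B * (\1_A x)%:E))%E); last first.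
  apply/funext => x /=; rewrite indicE; have [xA|xA] := boolP (x \in A).
    rewrite mule1 -(lebesgue_measureD (t * x) mB); congr (mu _).
    apply/seteqP; split => y /=.
      by rewrite /xsection/= inE => -[].
    move=> By; rewrite /xsection/=; apply/mem_set; split => //=.
    exact: set_mem xA.
  rewrite mule0 (_ : xsection _ _ = set0) ?measure0//.
  apply/seteqP; split => y //=; rewrite /xsection/= inE => -[/= Ax _].
  by rewrite notin_setE in xA.
rewrite ge0_integralZl//.
- by rewrite integral_indic// setIT muleC.
- exact/measurable_EFinP/measurable_indic.
Qed.

(** For an angle theta with cosine [c] and sine [s], the number [t] is tan(theta / 2), and the
    rotation is a horizontal shear by [t], then a vertical one by [- s], then again the horizontal
    one by [t]. *)
Lemma preserves_plane_lebesgue_rotation (c s : R) :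
  c ^+ 2 + s ^+ 2 = 1 -> s != 0 ->
  preserves_plane_lebesgue (fun z => (c * z.1 + s * z.2, c * z.2 - s * z.1)).
Proof.
move=> cs s0; pose t := (1 - c) / s.
have := preserves_plane_lebesgue_swap; set sw := (fun z => (z.2, z.1)) => psw.
have psh := preserves_plane_lebesgue_shear.
(* Conjugation by the swap of coordinates turns the vertical shear into a horizontal one. *)
have pxsh r := preserves_plane_lebesgue_comp psw
  (preserves_plane_lebesgue_comp (psh r) psw).
have := preserves_plane_lebesgue_comp (pxsh t)
  (preserves_plane_lebesgue_comp (psh (- s)) (pxsh t)).
congr preserves_plane_lebesgue.
have ts : t * s = 1 - c by rewrite /t divfK.
(* Half-angle identity: multiplied by [s], it reads (1 - c) * (1 + c) = s ^+ 2. *)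
have tc : t * (1 + c) = s.
  apply: (mulIf s0); rewrite mulrAC ts -expr2 -[RHS](addKr (c ^+ 2)) cs.
  by ring.
apply/funext => -[x y]; rewrite /sw/=; congr pair; last first.
  rewrite [in RHS](_ : c = 1 - t * s); last by rewrite ts; ring.
  by ring.
rewrite -[s in RHS]tc [X in _ = X * _ + _](_ : c = 1 - t * s); last first.
  by rewrite ts; ring.
have -> : t * (1 + c) = t * (2 - t * s) by rewrite ts; ring.
by ring.
Qed.

End plane_lebesgue.

(** * The standard normal law on the line and on the plane *)

Section standard_normal_plane.
Context {R : realType}.
Local Open Scope classical_set_scope.
Local Notation RR := (measurableTypeR R).
Local Notation mu := (@lebesgue_measure R).
Local Notation gauss := (@normal_prob R 0 1).
Local Notation phi := (@normal_pdf R 0 1).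

(** The Radon-Nikodym derivative of the normal law and [normal_pdf] have the same integral over
    every measurable set, so they agree almost everywhere. *)
Lemma ge0_integral_normal_prob (m s : R) (f : RR -> \bar R) :
  measurable_fun [set: RR] f -> (forall x, 0 <= f x)%E ->
  (\int[normal_prob m s]_x f x = \int[mu]_x (f x * (normal_pdf m s x)%:E))%E.
Proof.
move=> mf f0; have dom := normal_prob_dominates m s.
rewrite -(Radon_Nikodym_SigmaFinite.change_of_variables dom)//.
have mpdf : measurable_fun [set: RR] (EFin \o normal_pdf m s).
  by apply/measurable_EFinP; exact: measurable_normal_pdf.
have mrn := measurable_int mu (Radon_Nikodym_SigmaFinite.f_integrable dom).
apply: ae_eq_integral => //; [exact: emeasurable_funM..|].
apply: ae_eqe_mul2l; apply: integral_ae_eq => //.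
  exact: Radon_Nikodym_SigmaFinite.f_integrable.
by move=> E _ mE; rewrite -Radon_Nikodym_SigmaFinite.f_integral.
Qed.

(** The density is even and Lebesgue measure is invariant under x -> - x. *)
Lemma normal_prob01N (A : set RR) : measurable A ->
  gauss (-%R @^-1` A) = gauss A.
Proof.
move=> mA.
have mphi : measurable_fun [set: RR] (EFin \o phi).
  by apply/measurable_EFinP; exact: measurable_normal_pdf.
rewrite /normal_prob.
transitivity (\int[mu]_(x in -%R @^-1` A) ((EFin \o phi) \o -%R) x)%E.
  apply: eq_integral => x _ /=.
  by rewrite !normal_pdfE ?oner_neq0// /normal_fun !subr0 sqrrN.
rewrite -(@ge0_integral_pushforward _ _ _ _ _ (-%R : RR -> RR))//=.
- by apply: eq_measure_integral => //= B mB _; exact: lebesgue_measureN.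
- exact: measurable_funTS.
- by move=> x _; rewrite lee_fin normal_pdf_ge0.
Qed.

(** By Tonelli, the product law gets a density with respect to the plane Lebesgue measure, whose
    rotation invariance then becomes usable. *)
Lemma plane_normalE (D : set (RR * RR)) : measurable D ->
  ((gauss \x gauss) D =
   \int[mu \x mu]_(z in D) (phi z.1 * phi z.2)%:E)%E.
Proof.
move=> mD.
have mphi : measurable_fun [set: RR] phi := measurable_normal_pdf 0 1.
have mphi2 :
    measurable_fun [set: RR * RR] (fun z : RR * RR => phi z.1 * phi z.2).
  by apply: measurable_funM; apply: (measurableT_comp mphi);
    [exact: measurable_fst|exact: measurable_snd].
rewrite [RHS]integral_mkcond fubini_tonelli1//=; last 2 first.
- by apply/(measurable_restrictT _ mD)/measurable_funTS/measurable_EFinP.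
- by apply: erestrict_ge0 => z _; rewrite lee_fin mulr_ge0// normal_pdf_ge0.
rewrite /product_measure1 ge0_integral_normal_prob//; last first.
  exact: measurable_fun_xsection.
apply: eq_integral => x _.
rewrite /fubini_F /= muleC /normal_prob integral_mkcond -ge0_integralZl//.
- apply: eq_integral => y _; rewrite !patchE mem_xsection.
  by case: ifP => _; rewrite ?mule0.
- have mDx : measurable (xsection D x) by exact: measurable_xsection.
  exact/(measurable_restrictT _ mDx)/measurable_funTS/measurable_EFinP.
- by move=> y _; apply: erestrict_ge0 => z _; rewrite lee_fin normal_pdf_ge0.
- by rewrite lee_fin normal_pdf_ge0.
Qed.

Lemma normal_pdf01_rotation (c s x y : R) : c ^+ 2 + s ^+ 2 = 1 ->
  phi (c * x + s * y) * phi (c * y - s * x) = phi x * phi y.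
Proof.
move=> cs; rewrite !normal_pdfE ?oner_neq0// /normal_fun !subr0.
rewrite mulrACA [RHS]mulrACA -!expRD; congr (_ * expR _).
rewrite -!mulrDl; congr (_ / _).
transitivity (- ((c ^+ 2 + s ^+ 2) * (x ^+ 2 + y ^+ 2))); first by ring.
by rewrite cs; ring.
Qed.

Lemma plane_normal_rotation (c s : R) (A B : set RR) :
  c ^+ 2 + s ^+ 2 = 1 -> s != 0 -> measurable A -> measurable B ->
  ((gauss \x gauss)
    [set z | A (c * z.1 + s * z.2)%R /\ B (c * z.2 - s * z.1)%R] =
   gauss A * gauss B)%E.
Proof.
move=> cs s0 mA mB.
transitivity ((gauss \x gauss) (A `*` B))%E; last exact: product_measure1E.
pose rot (z : RR * RR) : RR * RR := (c * z.1 + s * z.2, c * z.2 - s * z.1).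
have [mrot prot] : preserves_plane_lebesgue rot.
  exact: preserves_plane_lebesgue_rotation.
have mAB : measurable (A `*` B) by exact: measurableX.
rewrite -[X in ((_ \x _) X = _)%E]/(rot @^-1` (A `*` B)).
have mrAB : measurable (rot @^-1` (A `*` B)).
  by rewrite -[X in measurable X]setTI; exact: mrot.
have mphi : measurable_fun [set: RR] phi := measurable_normal_pdf 0 1.
rewrite !plane_normalE//.
pose h (z : RR * RR) := (phi z.1 * phi z.2)%:E.
transitivity (\int[(mu \x mu)%E]_(z in rot @^-1` (A `*` B)) (h \o rot) z)%E.
  by apply: eq_integral => z _; rewrite /h /= normal_pdf01_rotation.
transitivity (\int[pushforward (mu \x mu)%E rot]_(z in A `*` B) h z)%E.
  apply/esym/ge0_integral_pushforward => //.
  - apply/measurable_funTS/measurable_EFinP.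
    by apply: measurable_funM; apply: (measurableT_comp mphi);
      [exact: measurable_fst|exact: measurable_snd].
  - by move=> z _; rewrite lee_fin mulr_ge0// normal_pdf_ge0.
by apply: eq_measure_integral => D mD _; exact: prot.
Qed.

End standard_normal_plane.

(** * Finite measures determined by their values on rectangles or boxes *)

Section measure_uniqueness.
Context {R : realType}.
Local Open Scope classical_set_scope.

(** Rectangles are stable under intersection and generate the product sigma-algebra; as the mass is
    finite, the exhausting sequence can be constantly the whole space. *)
Lemma eq_measure_rect d1 d2 (T1 : measurableType d1) (T2 : measurableType d2)
    (m1 m2 : {measure set (T1 * T2) -> \bar R}) : (m1 setT < +oo)%E ->
    (forall A B, measurable A -> measurable B -> m1 (A `*` B) = m2 (A `*` B)) ->
  forall D, measurable D -> m1 D = m2 D.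
Proof.
move=> m1oo m12.
pose G := [set A `*` B | A in @measurable _ T1 & B in @measurable _ T2].
apply: (measure_unique G (fun=> setT)) => //.
- exact: measurable_prod_measurableType.
- move=> _ _ [A mA [B mB <-]] [A' mA' [B' mB' <-]]; rewrite -setXI.
  by exists (A `&` A'); [exact: measurableI|exists (B `&` B') => //;
    exact: measurableI].
- by move=> _; exists setT => //; exists setT; rewrite ?setXTT.
- by rewrite bigcup_const//; exists 0.
- by move=> _ [A mA [B mB <-]]; exact: m12.
Qed.

Lemma measurable_box k (B : 'I_k -> set R) : (forall i, measurable (B i)) ->
  measurable [set z : 'cV[R]_k | forall i, B i (z i 0)].
Proof.
move=> mB; rewrite (_ : [set z | _] =
    \bigcap_(i in [set: 'I_k]) [set z : 'cV[R]_k | B i (z i 0)]); last first.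
  by apply/seteqP; split => z /= zB i; [move=> _|]; exact: (zB i).
apply: fin_bigcap_measurable => // i _.
rewrite -[X in measurable X]setTI.
exact: (measurable_entry (T := R)).
Qed.

Lemma eq_measure_box k (m1 m2 : {measure set 'cV[R]_k -> \bar R}) :
    (m1 setT < +oo)%E ->
    (forall B : 'I_k -> set R, (forall i, measurable (B i)) ->
      m1 [set z | forall i, B i (z i 0)] = m2 [set z | forall i, B i (z i 0)]) ->
  forall D, measurable D -> m1 D = m2 D.
Proof.
move=> m1oo m12.
pose G : set (set 'cV[R]_k) := [set C | exists2 B : 'I_k -> set R,
  (forall i, measurable (B i)) &
  C = [set z : 'cV[R]_k | forall i, B i (z i 0)]].
apply: (measure_unique G (fun=> setT)) => //.
- apply/seteqP; split.
    apply: smallest_sub; first exact: smallest_sigma_algebra.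
    move=> _ [i [j [B [mB ->]]]]; apply: sub_sigma_algebra.
    (* The preimage of [B] under entry [i] is the box with side [i] as its only constrained side. *)
    exists (fun l => if l == i then B else setT).
      by move=> l; case: ifP.
    apply/seteqP; split => z /=; rewrite (ord1 j).
      by move=> Bz l; case: eqP => // ->.
    by move=> /(_ i); rewrite eqxx.
  apply: smallest_sub; first exact: sigma_algebra_measurable.
  by move=> _ [B mB ->]; exact: measurable_box.
- move=> _ _ [A mA ->] [B mB ->]; exists (fun i => A i `&` B i).
    by move=> i; exact: measurableI.
  apply/seteqP; split => z /= => [[Az Bz] i //|AB].
  by split => i; have [] := AB i.
- by move=> _; exists (fun=> setT) => //; apply/seteqP; split.
- by rewrite bigcup_const//; exists 0.
- by move=> _ [B mB ->]; exact: m12.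
Qed.

End measure_uniqueness.

(** * Matrices of rotations of a coordinate plane *)

Section rotation_matrix.
Context {R : comPzRingType} {k : nat}.
Implicit Types (i j : 'I_k) (c s : R).

(** A Givens rotation, oriented like the plane map (c x + s y, c y - s x) above; [*+] by a boolean
    acts as a Kronecker delta. *)
Definition rotation_mx i j c s : 'M[R]_k := \matrix_(l, m)
  if l == i then c *+ (m == i) + s *+ (m == j)
  else if l == j then c *+ (m == j) - s *+ (m == i) else (l == m)%:R.

Lemma mul_rotation_mxE n i j c s (z : 'M[R]_(k, n)) l p :
  (rotation_mx i j c s *m z) l p =
  if l == i then c * z i p + s * z j p
  else if l == j then c * z j p - s * z i p else z l p.
Proof.
have sumE (a : R) (q : 'I_k) : \sum_m (a *+ (m == q)) * z m p = a * z q p.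
  rewrite (bigD1 q)//= eqxx big1 ?addr0// => m /negPf ->.
  by rewrite mul0r.
rewrite mxE; under eq_bigr do rewrite mxE.
case: ifP => _.
  by under eq_bigr do rewrite mulrDl; rewrite big_split/= !sumE.
case: ifP => _.
  by under eq_bigr do rewrite mulrBl; rewrite sumrB !sumE.
by rewrite -[RHS]mul1r -sumE; apply: eq_bigr => m _; rewrite eq_sym.
Qed.

Lemma trmx_rotation_mx i j c s : i != j ->
  (rotation_mx i j c s)^T = rotation_mx i j c (- s).
Proof.
move=> ij; have ji : j != i by rewrite eq_sym.
apply/matrixP => l m; rewrite !mxE.
rewrite [m == l]eq_sym.
pose simp := (mulr0n, mulr1n, sub0r, subr0, opprK, oppr0, addr0).
have [->|li] := eqVneq l i; have [->|mi] := eqVneq m i;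
  rewrite ?eqxx ?(negPf ij) ?(negPf ji) ?simp//.
- by case: (m == j); rewrite ?simp ?add0r.
- by case: (l == j); rewrite ?simp ?add0r ?(negPf li).
- have [->|mj] := eqVneq m j; first by case: (l == j); rewrite ?simp.
  by case: (eqVneq l j) => // ->; rewrite simp eq_sym (negPf mj).
Qed.

Lemma rotation_mxK i j c s : i != j -> c ^+ 2 + s ^+ 2 = 1 ->
  (rotation_mx i j c s)^T *m rotation_mx i j c s = 1%:M.
Proof.
move=> ij cs; have ji : j != i by rewrite eq_sym.
(* Letting the product act on the identity matrix allows the entry formula to be applied twice. *)
rewrite trmx_rotation_mx// -[rotation_mx i j c s]mulmx1.
apply/matrixP => l m; rewrite !mul_rotation_mxE !eqxx (negPf ji).
case: eqVneq => [->|li].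
  by rewrite -[RHS]mul1r -cs; ring.
by case: eqVneq => [->|lj //]; rewrite -[RHS]mul1r -cs; ring.
Qed.

End rotation_matrix.

(** * Rotation invariance of the standard normal vector *)

Section standard_normal_vector.
Context {R : realType} {k : nat}.
Local Open Scope classical_set_scope.
Local Notation RR := (measurableTypeR R).
Local Notation gauss := (@normal_prob R 0 1).
Implicit Types nu : probability 'cV[R]_k R.

(** Isolates the factor of one coordinate, so that this side of a box can vary while the others stay
    fixed. *)
Lemma standard_normal_slab nu (i : 'I_k) (A : set R) (B : 'I_k -> set R) :
  standard_normal_law nu -> measurable A -> (forall l, measurable (B l)) ->
  nu [set z | A (z i 0) /\ forall l, l != i -> B l (z l 0)] =
  (gauss A * (\prod_(l | l != i) fine (gauss (B l)))%:E)%E.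
Proof.
move=> nuN mA mB.
pose C l := if l == i then A else B l.
have mC l : measurable (C l) by rewrite /C; case: ifP.
rewrite (_ : [set z | _] = [set z | forall l, C l (z l 0)]); last first.
  apply/seteqP; split => z /=.
    by move=> [Az Bz] l; rewrite /C; case: eqVneq => [->//|]; exact: Bz.
  by move=> Cz; split => [|l li]; [have := Cz i|have := Cz l];
    rewrite /C ?eqxx// (negPf li).
rewrite nuN// (bigD1 i)//= {1}/C eqxx EFinM fineK; last exact: fin_num_measure.
congr (_ * _%:E)%E; apply: eq_bigr => l li.
by rewrite /C (negPf li).
Qed.

Lemma standard_normal_coord nu (i : 'I_k) (A : set R) :
  standard_normal_law nu -> measurable A ->
  nu [set z | A (z i 0)] = gauss A.
Proof.
move=> nuN mA.
rewrite (_ : [set z | _] =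
    [set z | A (z i 0) /\ forall l, l != i -> [set: R] (z l 0)]); last first.
  by apply/seteqP; split => z //= [].
rewrite (@standard_normal_slab _ _ _ (fun=> setT))// big1 ?mule1// => l _.
by have := @probability_setT _ _ _ gauss => /= ->.
Qed.

(** While the other coordinates are confined to their sides of the box (the event [E], of
    probability [p]), the pair of coordinates [i] and [j] follows [p] times the plane normal law,
    which is rotation invariant. *)
Lemma standard_normal_rotation nu (i j : 'I_k) (c s : R) :
  standard_normal_law nu -> i != j -> c ^+ 2 + s ^+ 2 = 1 -> s != 0 ->
  standard_normal_law (distribution nu (mulmx (rotation_mx i j c s))).
Proof.
move=> nuN ij cs s0 B mB; have ji : j != i by rewrite eq_sym.
pose E := [set z : 'cV[R]_k | forall l, l != i -> l != j -> B l (z l 0)].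
have mE : measurable E.
  pose C l := if (l == i) || (l == j) then setT else B l.
  rewrite (_ : E = [set z | forall l : 'I_k, C l (z l 0)]).
    by apply: (@measurable_box _ _ C) => l; rewrite /C; case: ifP.
  rewrite /C; apply/seteqP; split => z /= Bz l.
    by case: ifP => // /norP[]; exact: Bz.
  by move=> li lj; have := Bz l; rewrite (negPf li) (negPf lj).
pose p := \prod_(l | (l != i) && (l != j)) fine (gauss (B l)).
have p0 : 0 <= p by apply: prodr_ge0 => l _; exact: fine_ge0.
pose pr (z : 'cV[R]_k) : RR * RR := (z i 0, z j 0).
have mpr : measurable_fun setT pr.
  exact: (measurable_fun_pair (@measurable_entry _ R k 1 i 0)
    (@measurable_entry _ R k 1 j 0)).
have mrect (A A' : set RR) : measurable A -> measurable A' ->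
    pushforward (mrestr nu mE) pr (A `*` A') = (p%:E * (gauss A * gauss A'))%E.
  move=> mA mA'; rewrite /pushforward /mrestr.
  rewrite (_ : _ `&` E = [set z | A (z i 0) /\
      forall l, l != i -> (if l == j then A' else B l) (z l 0)]); last first.
    apply/seteqP; split => z /=.
      move=> [[Az A'z] Ez]; split => // l li.
      by case: eqVneq => [->//|]; exact: Ez.
    move=> [Az Bz]; split; first by split => //; have := Bz j ji; rewrite eqxx.
    by move=> l li lj; have := Bz l li; rewrite (negPf lj).
  rewrite (@standard_normal_slab nu i A (fun l => if l == j then A' else B l))//;
    last by move=> l; case: ifP.
  rewrite (bigD1 j)//= eqxx EFinM fineK; last exact: fin_num_measure.
  rewrite muleA muleC; congr (_%:E * _)%E.
  by apply: eq_bigr => l /andP[_ /negPf ->].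
(* A rotated rectangle need not be a product set, so the formula is extended to all measurable sets
   of the plane. *)
have mD (D : set (RR * RR)) : measurable D ->
    nu (pr @^-1` D `&` E) = (p%:E * (gauss \x gauss) D)%E.
  move=> mD.
  apply: (@eq_measure_rect _ _ _ _ _ (pushforward (mrestr nu mE) pr)
    (mscale (NngNum p0) (gauss \x gauss)%E)) => //.
    (* With both sides equal to the whole line, the total mass is seen to be [p], hence finite. *)
    have := mrect setT setT measurableT measurableT.
    have -> : gauss setT = 1%E := @probability_setT _ _ _ gauss.
    by rewrite setXTT !mule1 => pE; have := ltry p; rewrite -pE.
  move=> A A' mA mA'; apply: (etrans (mrect _ _ mA mA')).
  by rewrite /mscale/=; congr (_ * _)%E; exact/esym/product_measure1E.
transitivity (nu (pr @^-1` [set z | B i (c * z.1 + s * z.2)%R /\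
    B j (c * z.2 - s * z.1)%R] `&` E)).
  congr (nu _); apply/seteqP; split => z /=.
    move=> Bz; split; first split.
    - by have := Bz i; rewrite mul_rotation_mxE eqxx.
    - by have := Bz j; rewrite mul_rotation_mxE eqxx (negPf ji).
    - move=> l li lj; have := Bz l.
      by rewrite mul_rotation_mxE (negPf li) (negPf lj).
  move=> [[Bi Bj] Ez] l; rewrite mul_rotation_mxE.
  by case: eqVneq => [->//|li]; case: eqVneq => [->//|]; exact: Ez.
rewrite mD.
  rewrite (plane_normal_rotation cs s0 (mB i) (mB j)).
  rewrite (bigD1 i)// (bigD1 j)//= !EFinM !fineK.
  - by rewrite [LHS]muleC -muleA.
  - by apply: fin_num_measure; exact: (mB j).
  - by apply: fin_num_measure; exact: (mB i).
have mrot : measurable_fun [set: RR * RR]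
    ((fun z => (c * z.1 + s * z.2, c * z.2 - s * z.1)) : RR * RR -> RR * RR).
  by have [] := preserves_plane_lebesgue_rotation cs s0.
rewrite -[X in measurable X]setTI.
exact: (mrot measurableT (B i `*` B j) (measurableX (mB i) (mB j))).
Qed.

End standard_normal_vector.

(** * Independence of orthogonal linear images of a standard normal vector *)

Section orthogonal_independence.
Context {R : realType} {k : nat}.
Local Open Scope classical_set_scope.
Local Notation gauss := (@normal_prob R 0 1).
Implicit Types nu : probability 'cV[R]_k R.

(** Erasing a coordinate instead of deleting it keeps the dimension: functions of the other
    coordinates factor through this map without reindexing. *)
Definition zero_coord (i : 'I_k) (z : 'cV[R]_k) : 'cV[R]_k :=
  \col_l (if l == i then 0 else z l 0).

Lemma measurable_zero_coord i : measurable_fun setT (zero_coord i).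
Proof.
apply: measurable_fun_matrix => l j.
have [->|li] := eqVneq l i.
  by under eq_fun do rewrite mxE eqxx; exact: measurable_cst.
under eq_fun do rewrite mxE (negPf li).
exact: measurable_entry.
Qed.

(** For fixed [A], both sides are finite measures in [B], so it suffices to compare them on boxes,
    where the law factorizes. *)
Lemma standard_normal_zero_coord_indep nu (i : 'I_k) (A : set R)
    (B : set 'cV[R]_k) :
  standard_normal_law nu -> measurable A -> measurable B ->
  nu ([set z : 'cV[R]_k | A (z i 0)%R] `&` zero_coord i @^-1` B) =
  (nu [set z : 'cV[R]_k | A (z i 0)%R] * nu (zero_coord i @^-1` B))%E.
Proof.
move=> nuN mA mB; have mzero := measurable_zero_coord i.
have mAi : measurable [set z : 'cV[R]_k | A (z i 0)].
  rewrite -[X in measurable X]setTI.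
  exact: (@measurable_entry _ R k 1 i 0).
have nuAi : nu [set z : 'cV[R]_k | A (z i 0)%R] = (fine (gauss A))%:E.
  by rewrite standard_normal_coord// fineK//; exact: fin_num_measure.
have p0 : 0 <= fine (gauss A) by exact: fine_ge0.
rewrite nuAi setIC.
apply: (@eq_measure_box _ _ (pushforward (mrestr nu mAi) (zero_coord i))
  (mscale (NngNum p0) (pushforward nu (zero_coord i)))) => //.
  rewrite /= /pushforward /mrestr preimage_setT setTI.
  by apply: le_lt_trans (probability_le1 _ mAi) _; exact: ltry.
move=> C mC; set S := (S in _ S = _ S).
rewrite -[RHS]/((fine (gauss A))%:E * nu (zero_coord i @^-1` S))%E.
rewrite -[LHS]/(nu (zero_coord i @^-1` S `&`
  [set z : 'cV[R]_k | A (z i 0)])) /S.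
(* Entry [i] of [zero_coord i z] is 0: if 0 lies in side [i] of the box, this side imposes nothing;
   otherwise the preimage is empty. *)
have [Ci0|Ci0] := pselect (C i 0).
  have -> : zero_coord i @^-1` [set z | forall l, C l (z l 0)] =
      [set z | [set: R] (z i 0) /\ forall l, l != i -> C l (z l 0)].
    apply/seteqP; split => z /=.
      by move=> Cz; split => // l li; have := Cz l; rewrite mxE (negPf li).
    by move=> [_ Cz] l; rewrite mxE; case: eqVneq => [->//|]; exact: Cz.
  rewrite (@standard_normal_slab _ _ nu i setT C)//.
  have -> : [set z : 'cV[R]_k | [set: R] (z i 0) /\
        forall l, l != i -> C l (z l 0)] `&` [set z : 'cV[R]_k | A (z i 0)%R] =
      [set z | A (z i 0) /\ forall l, l != i -> C l (z l 0)].
    by apply/seteqP; split => z /= => [[[]]|[]].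
  rewrite (@standard_normal_slab _ _ nu i A C)// fineK; last exact: fin_num_measure.
  have -> : gauss setT = 1%E := @probability_setT _ _ _ gauss.
  by rewrite mul1e.
have -> : zero_coord i @^-1` [set z | forall l, C l (z l 0)] = set0.
  by apply/seteqP; split => z //= /(_ i); rewrite mxE eqxx.
by rewrite set0I measure0 mule0.
Qed.

Lemma measurable_preimage_mulmx m n (M : 'M[R]_(m, n)) (B : set 'cV[R]_m) :
  measurable B -> measurable (mulmx M @^-1` B).
Proof.
by move=> mB; rewrite -[X in measurable X]setTI; exact: measurable_mulmx.
Qed.

(* Induction on the number of nonzero entries of [a]: a plane rotation, which
   preserves the law of [z], cancels one of them. *)
Lemma standard_normal_orthogonal_indep nu n (a : 'cV[R]_k) (C : 'M[R]_(n, k))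
    (A : set 'cV[R]_1) (B : set 'cV[R]_n) :
  standard_normal_law nu -> C *m a = 0 -> measurable A -> measurable B ->
  nu (mulmx a^T @^-1` A `&` mulmx C @^-1` B) =
  (nu (mulmx a^T @^-1` A) * nu (mulmx C @^-1` B))%E.
Proof.
move=> + + mA mB.
pose supp (b : 'cV[R]_k) := [set l | b l 0 != 0]%SET.
have [N] := ubnP #|supp a|.
elim: N nu a C => // N IH nu a C aN nuN Ca0.
(* If [a] is 0, then [a^T *m z] is constantly 0 and its event is the whole space or empty. *)
have [i ai|a0] := pickP (fun l => a l 0 != 0); last first.
  have -> : a = 0.
    by apply/matrixP => l j; rewrite ord1 mxE; apply/eqP/negPn; rewrite a0.
  rewrite trmx0; have [A0|A0] := pselect (A 0).
    have -> : mulmx 0 @^-1` A = [set: 'cV[R]_k].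
      by apply/seteqP; split => z //= _; rewrite mul0mx.
    by rewrite setTI probability_setT mul1e.
  have -> : mulmx 0 @^-1` A = (set0 : set 'cV[R]_k).
    by apply/seteqP; split => z //=; rewrite mul0mx.
  by rewrite set0I measure0 mul0e.
have [j /andP[ji aj]|ai0] := pickP (fun l => (l != i) && (a l 0 != 0)).
  have ij : i != j by rewrite eq_sym.
  pose r := Num.sqrt (a i 0 ^+ 2 + a j 0 ^+ 2).
  have sum0 : 0 < a i 0 ^+ 2 + a j 0 ^+ 2.
    by rewrite ltr_wpDr ?sqr_ge0// exprn_even_gt0.
  have r0 : r != 0 by rewrite gt_eqF// sqrtr_gt0.
  have r2 : r ^+ 2 = a i 0 ^+ 2 + a j 0 ^+ 2 by rewrite sqr_sqrtr// ltW.
  (* The angle that makes entry [j] of [G *m a], namely c * a j 0 - s * a i 0, vanish. *)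
  pose c := a i 0 / r; pose s := a j 0 / r.
  have cs : c ^+ 2 + s ^+ 2 = 1.
    by rewrite !expr_div_n -mulrDl -r2 divff// expf_neq0.
  have s0 : s != 0 by rewrite mulf_neq0// invr_neq0.
  pose G := rotation_mx i j c s.
  have GK : G^T *m G = 1%:M by exact: rotation_mxK.
  have GaN : (#|supp (G *m a)| < N)%N.
    rewrite -ltnS; apply: leq_trans aN; rewrite !ltnS.
    apply: proper_card; apply/properP; split.
      apply/fintype.subsetP => l; rewrite !inE mul_rotation_mxE.
      by case: (eqVneq l i) => [->//|li]; case: (eqVneq l j) => [->//|].
    exists j; rewrite !inE// mul_rotation_mxE (negPf ji) eqxx negbK.
    by rewrite /c /s; apply/eqP; ring.
  have GN := standard_normal_rotation nuN ij cs s0.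
  have CGa : (C *m G^T) *m (G *m a) = 0.
    by rewrite -mulmxA [G^T *m _]mulmxA GK mul1mx.
  (* As [G^T *m G] is the identity, both events are preimages under [G] of the events for [G *m a]
     and [C *m G^T], to which induction applies with the law of [G *m z]. *)
  have -> : mulmx a^T @^-1` A = mulmx G @^-1` (mulmx (G *m a)^T @^-1` A).
    by apply/seteqP; split => z /=;
      rewrite trmx_mul -mulmxA [G^T *m _]mulmxA GK mul1mx.
  have -> : mulmx C @^-1` B = mulmx G @^-1` (mulmx (C *m G^T) @^-1` B).
    by apply/seteqP; split => z /=; rewrite -mulmxA [G^T *m _]mulmxA GK mul1mx.
  exact: (IH _ _ _ GaN GN CGa).
(* Now [a] is supported at [i] alone: [a^T *m z] depends only on entry [i] of [z], and [C *m a = 0]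
   makes column [i] of [C] vanish. *)
have al l : l != i -> a l 0 = 0.
  by move=> li; apply/eqP/negPn; have := ai0 l; rewrite li /= => ->.
have aE (z : 'cV[R]_k) : a^T *m z = const_mx (a i 0 * z i 0).
  apply/matrixP => x y; rewrite (ord1 x) (ord1 y) !mxE.
  rewrite (bigD1 i)//= big1 ?addr0 ?mxE//.
  by move=> l /al; rewrite mxE => ->; rewrite mul0r.
have CE z : C *m zero_coord i z = C *m z.
  apply/matrixP => x y; rewrite (ord1 y) !mxE; apply: eq_bigr => l _.
  rewrite mxE; case: eqVneq => [->|//].
  have /matrixP/(_ x 0) := Ca0; rewrite !mxE (bigD1 i)//= big1 => [|q /al ->].
    move=> /eqP; rewrite addr0 mulf_eq0 (negPf ai) orbF => /eqP ->.
    by rewrite !mul0r.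
  by rewrite mulr0.
pose f (x : R) : 'cV[R]_1 := const_mx (a i 0 * x).
have mf : measurable_fun setT f.
  apply: measurable_fun_matrix => x y; under eq_fun do rewrite mxE.
  by apply: measurable_funM; [exact: measurable_cst|exact: measurable_id].
have mfA : measurable (f @^-1` A).
  by rewrite -[X in measurable X]setTI; exact: mf.
have -> : mulmx a^T @^-1` A = [set z : 'cV[R]_k | (f @^-1` A) (z i 0)].
  by apply/seteqP; split => z /=; rewrite aE.
have -> : mulmx C @^-1` B = zero_coord i @^-1` (mulmx C @^-1` B).
  by apply/seteqP; split => z /=; rewrite CE.
apply: standard_normal_zero_coord_indep => //.
exact: measurable_preimage_mulmx.
Qed.

End orthogonal_independence.

(** * Expectations: equality of laws, sign changes, linear combinations *)

Section expectation_complements.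
Context {R : realType}.
Local Open Scope classical_set_scope.

(** The two variables may live on different probability spaces, as is needed to pass from eps to its
    representation A Z + b. *)
Lemma eq_law_expectation d1 d2 d (T1 : measurableType d1)
    (T2 : measurableType d2) (S : measurableType d)
    (P1 : probability T1 R) (P2 : probability T2 R)
    (X1 : T1 -> S) (X2 : T2 -> S) (f : S -> R) :
  measurable_fun setT X1 -> measurable_fun setT X2 -> measurable_fun setT f ->
  (forall B, measurable B -> P1 (X1 @^-1` B) = P2 (X2 @^-1` B)) ->
  f \o X1 \in Lfun P1 1 -> f \o X2 \in Lfun P2 1 ->
  'E_P1[f \o X1]%E = 'E_P2[f \o X2]%E.
Proof.
move=> mX1 mX2 mf X12 /Lfun1_integrable f1 /Lfun1_integrable f2.
have mEf : measurable_fun setT (EFin \o f) by exact/measurable_EFinP.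
rewrite unlock.
transitivity (\int[pushforward P1 X1]_y (EFin \o f) y)%E.
  by rewrite (integral_pushforward mX1).
transitivity (\int[pushforward P2 X2]_y (EFin \o f) y)%E.
  by apply: eq_measure_integral => B mB _; exact: X12.
by rewrite (integral_pushforward mX2).
Qed.

(** Integrability makes the expectation a real number equal to its opposite. The symmetry arguments
    on moments below all end here. *)
Lemma eqN_expectation_eq0 d (T : measurableType d) (P : probability T R)
    (f : T -> R) :
  f \in Lfun P 1 -> 'E_P[f]%E = 'E_P[\- f]%E -> 'E_P[f]%E = 0%E.
Proof.
move=> f1; rewrite (_ : \- f = -1 \o* f); last first.
  by apply/funext => w /=; rewrite mulrN1.
rewrite expectationZl// -(fineK (expectation_fin_num f1)) -EFinM mulN1r.
by move=> -[] /eqP; rewrite -addr_eq0 -mulr2n mulrn_eq0/= => /eqP ->.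
Qed.

Context d (T : measurableType d) (P : probability T R) (I : finType).
Implicit Types (a : I -> R) (f : I -> T -> R).

Lemma Lfun_lincomb a f (r : R) : 1 <= r -> (forall i, f i \in Lfun P r%:E) ->
  (fun w => \sum_i a i * f i w) \in Lfun P r%:E.
Proof.
move=> r1 fr; have r1' : (1 <= r%:E)%E by rewrite lee_fin.
rewrite (_ : (fun w => _) = \sum_i (a i *: f i)); last first.
  by apply/funext => w; rewrite fct_sumE.
by rewrite rpred_sum => // i _; rewrite rpredZ.
Qed.

Lemma expectation_lincomb a f : (forall i, f i \in Lfun P 1) ->
  'E_P[fun w => (\sum_i a i * f i w)%R]%E = (\sum_i (a i)%:E * 'E_P[f i])%E.
Proof.
move=> f1; rewrite unlock.
under eq_integral do rewrite -sumEFin.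
rewrite integral_sum//=; last first.
  by move=> i; apply/Lfun1_integrable; exact: (rpredZ (a i) (f1 i)).
apply: eq_bigr => i _; under eq_integral do rewrite EFinM.
by rewrite integralZl//; exact/Lfun1_integrable.
Qed.

End expectation_complements.

(** * First and second moments of the standard normal vector *)

Section standard_normal_moments.
Context {R : realType}.
Local Open Scope classical_set_scope.
Local Notation RR := (measurableTypeR R).
Local Notation mu := (@lebesgue_measure R).
Local Notation gauss := (@normal_prob R 0 1).

(** Left unevaluated: that it is finite and nonzero suffices to read orthogonality off a vanishing
    mixed moment. *)
Definition normal_second_moment : \bar R := (\int[gauss]_x (x ^+ 2)%:E)%E.

Let msqr : measurable_fun [set: RR] (fun x : RR => (x ^+ 2)%:E).
Proof. exact/measurable_EFinP/measurable_funX/measurable_id. Qed.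

Let sqr_ge0E (x : RR) : (0 <= (x ^+ 2)%:E)%E.
Proof. by rewrite lee_fin sqr_ge0. Qed.

(* [x ^+ 2 <= 4 * expR (x ^+ 2 / 4)] bounds the integrand by a multiple of the
   density of variance 2. *)
Lemma normal_second_moment_lty : (normal_second_moment < +oo)%E.
Proof.
rewrite /normal_second_moment ge0_integral_normal_prob//.
pose s : R := Num.sqrt 2.
have s2 : s ^+ 2 = 2 by rewrite sqr_sqrtr.
have s0 : s != 0 by rewrite gt_eqF// sqrtr_gt0.
(* The quotient of peaks exchanges the normalizing constants of the two densities. *)
pose K : R := 4 * normal_peak 1 / normal_peak s.
have K0 : 0 <= K by rewrite !mulr_ge0// ?invr_ge0// normal_peak_ge0.
apply: (@le_lt_trans _ _ (\int[mu]_x (K%:E * (normal_pdf 0 s x)%:E))%E).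
  apply: ge0_le_integral => //.
  - by move=> x _; rewrite mule_ge0// lee_fin normal_pdf_ge0.
  - apply: emeasurable_funM => //.
    by apply/measurable_EFinP; exact: measurable_normal_pdf.
  - apply: emeasurable_funM => //.
    by apply/measurable_EFinP; exact: measurable_normal_pdf.
  - move=> x _; rewrite -!EFinM lee_fin !normal_pdfE ?oner_neq0// /K.
    have ps0 : normal_peak s != 0 by rewrite gt_eqF// normal_peak_gt0.
    have -> : 4 * normal_peak 1 / normal_peak s *
          (normal_peak s * normal_fun 0 s x) =
        normal_peak 1 * (4 * normal_fun 0 s x) by field.
    rewrite mulrCA ler_wpM2l ?normal_peak_ge0//.
    rewrite /normal_fun !subr0 s2 expr1n.
    (* Half of the exponent is that of the density of variance 2; the other half absorbs the factor
       x ^+ 2. *)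
    have -> : - x ^+ 2 / (1 *+ 2) = - x ^+ 2 / (2 *+ 2) - x ^+ 2 / 4 by field.
    rewrite expRD mulrCA mulrC ler_wpM2r ?expR_ge0//.
    have := expR_ge1Dx (x ^+ 2 / 4); rewrite expRN => h.
    rewrite ler_pdivrMr ?expR_gt0//.
    by lra.
rewrite ge0_integralZl//.
- by rewrite integral_normal_pdf mule1 ltry.
- by apply/measurable_EFinP; exact: measurable_normal_pdf.
- by move=> x _; rewrite lee_fin normal_pdf_ge0.
Qed.

(** Otherwise x ^+ 2 would vanish almost everywhere, although it vanishes only at 0, a null set; the
    whole line would then be null. *)
Lemma normal_second_moment_neq0 : normal_second_moment != 0%E.
Proof.
apply/eqP => m0.
have : (\int[gauss]_x `|(x ^+ 2)%:E| = 0)%E.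
  by rewrite -[RHS]m0; apply: eq_integral => x _; rewrite gee0_abs.
move=> /(ae_eq_integral_abs gauss measurableT msqr) [N [mN N0 subN]].
have g0 : gauss [set 0] = 0%E.
  have /null_content_dominatesP dom := normal_prob_dominates (0 : R) 1.
  by apply: dom => //; exact: lebesgue_measure_set1.
have gT : gauss setT = 1%E := @probability_setT _ _ _ gauss.
suff gT0 : gauss setT = 0%E.
  by move: gT; rewrite gT0 => /esym/eqP; rewrite onee_eq0.
apply/eqP; rewrite eq_le measure_ge0 andbT.
have <- : N `|` [set 0] = setT.
  rewrite -subTset => x _; have [->|x0] := eqVneq x 0; first by right.
  left; apply: subN => /= /(_ I) [] /eqP.
  by rewrite expf_eq0 (negPf x0).
have le0 (x : \bar R) : x = 0%E -> (x <= 0)%E by move=> ->.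
apply: le_trans (measureU2 gauss mN (measurable_set1 0)) _.
by rewrite -[leRHS]adde0; apply: leeD; apply: le0; [exact: N0|exact: g0].
Qed.

Context {k : nat} (nu : probability 'cV[R]_k R).
Hypothesis nuN : standard_normal_law nu.

Let mcoord (i : 'I_k) : measurable_fun setT (fun z : 'cV[R]_k => z i 0).
Proof. exact: measurable_entry. Qed.

Lemma standard_normal_sqr_coord i :
  (\int[nu]_z (z i 0%R ^+ 2)%:E)%E = normal_second_moment.
Proof.
pose c (z : 'cV[R]_k) : RR := z i 0.
have mc : measurable_fun setT c by exact: mcoord.
transitivity (\int[pushforward nu c]_x (x ^+ 2)%:E)%E.
  by rewrite (ge0_integral_pushforward mc).
by apply: eq_measure_integral => A mA _; exact: standard_normal_coord.
Qed.

Lemma standard_normal_coord_Lfun2 (i : 'I_k) :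
  (fun z : 'cV[R]_k => z i 0) \in Lfun nu 2%:E.
Proof.
rewrite inE; apply/andP; split; rewrite inE//= /finite_norm unlock poweR_lty//.
under eq_integral do rewrite /= powR_mulrn// real_normK ?num_real//.
by rewrite standard_normal_sqr_coord normal_second_moment_lty.
Qed.

Lemma standard_normal_coord_Lfun1 (i : 'I_k) :
  (fun z : 'cV[R]_k => z i 0) \in Lfun nu 1.
Proof.
apply: (Lfun_subset12 (fin_num_measure nu _ measurableT)).
exact: standard_normal_coord_Lfun2.
Qed.

Lemma standard_normal_mul_coord_Lfun1 (i j : 'I_k) :
  (fun z : 'cV[R]_k => z i 0 * z j 0) \in Lfun nu 1.
Proof. by apply: Lfun2_mul_Lfun1; exact: standard_normal_coord_Lfun2. Qed.

Lemma standard_normal_expectation_coord (i : 'I_k) :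
  'E_nu[fun z : 'cV[R]_k => (z i 0)%R]%E = 0%E.
Proof.
have z1 := standard_normal_coord_Lfun1 i.
have Nz1 : \- (fun z : 'cV[R]_k => z i 0) \in Lfun nu 1 by rewrite rpredN.
pose c (z : 'cV[R]_k) : RR := z i 0.
have mc : measurable_fun setT c by exact: mcoord.
have mNc : measurable_fun setT (\- c : _ -> RR) by exact: measurable_funN.
apply: eqN_expectation_eq0 => //.
apply: (@eq_law_expectation _ _ _ _ _ _ RR nu nu c (\- c) idfun) => //.
  exact: measurable_id.
move=> B mB.
have mNB : measurable (-%R @^-1` B : set RR).
  by rewrite -[X in measurable X]setTI; exact: (@oppr_measurable R setT).
rewrite [LHS](standard_normal_coord i nuN mB).
by rewrite [RHS](standard_normal_coord i nuN mNB) normal_prob01N.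
Qed.

(** The quarter turn (c = 0, s = 1) sends (z_i, z_j) to (z_j, - z_i): it preserves the law and
    changes the sign of the product. *)
Lemma standard_normal_expectation_mul_coord (i j : 'I_k) : i != j ->
  'E_nu[fun z : 'cV[R]_k => (z i 0 * z j 0)%R]%E = 0%E.
Proof.
move=> ij; have ji : j != i by rewrite eq_sym.
pose f (z : 'cV[R]_k) := z i 0 * z j 0.
have f1 : f \in Lfun nu 1 := standard_normal_mul_coord_Lfun1 i j.
pose G := rotation_mx i j (0 : R) 1.
have fG : f \o mulmx G = \- f.
  apply/funext => z /=; rewrite /f !mul_rotation_mxE !eqxx (negPf ji).
  by ring.
apply: eqN_expectation_eq0 => //; rewrite -fG.
apply: (@eq_law_expectation _ _ _ _ _ _ _ nu nu id (mulmx G) f) => //.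
- by apply: measurable_funM; exact: mcoord.
- move=> B mB; apply: (@eq_measure_box _ _ nu (distribution nu (mulmx G))) => //.
    by apply: le_lt_trans (probability_le1 _ _) _ => //; exact: ltry.
  have GN : standard_normal_law (distribution nu (mulmx G)).
    apply: standard_normal_rotation => //.
    by rewrite expr0n expr1n add0r.
  by move=> C mC; exact: etrans (nuN mC) (esym (GN _ mC)).
- by rewrite fG rpredN.
Qed.

(** Bilinear expansion: the off-diagonal terms vanish, and the diagonal ones share one second
    moment. *)
Lemma standard_normal_expectation_mul_linear (a c : 'cV[R]_k) :
  'E_nu[fun z : 'cV[R]_k =>
    ((\sum_l a l 0 * z l 0) * (\sum_l c l 0 * z l 0))%R]%E =
  ((\sum_l a l 0 * c l 0)%:E * normal_second_moment)%E.
Proof.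
pose g (l : 'I_k) (z : 'cV[R]_k) := \sum_m c m 0 * (z l 0 * z m 0).
have g1 l : g l \in Lfun nu 1.
  by apply: Lfun_lincomb => // m; exact: standard_normal_mul_coord_Lfun1.
rewrite (_ : (fun z : 'cV[R]_k => _) =
    (fun z => \sum_l a l 0 * g l z)); last first.
  apply/funext => z; rewrite big_distrl/=; apply: eq_bigr => l _.
  rewrite -mulrA; congr (_ * _); rewrite /g big_distrr/=.
  by apply: eq_bigr => m _; rewrite mulrCA.
have m2fin : normal_second_moment \is a fin_num.
  rewrite ge0_fin_numE ?normal_second_moment_lty//.
  by apply: integral_ge0.
rewrite expectation_lincomb// -(fineK m2fin) -EFinM mulr_suml -sumEFin.
apply: eq_bigr => l _.
rewrite expectation_lincomb; last first.
  by move=> m; exact: standard_normal_mul_coord_Lfun1.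
rewrite (bigD1 l)//= big1 ?adde0 => [|m ml]; last first.
  by rewrite standard_normal_expectation_mul_coord ?mule0// eq_sym.
rewrite [X in (_ * (_ * X))%E](_ : _ = normal_second_moment); last first.
  by rewrite unlock -(standard_normal_sqr_coord l).
by rewrite -[in LHS](fineK m2fin) -!EFinM mulrA.
Qed.

End standard_normal_moments.

(** * Consequences of the reflection symmetry *)

Section reflection_symmetry.
Context {R : realType} {d : measure_display} {T : measurableType d}.
Variable P : probability T R.
Local Open Scope classical_set_scope.

Lemma coordinate_mulmx m n (M : 'M[R]_(n, m)) (eps : T -> 'cV[R]_m) (i : 'I_n) :
  coordinate (mulmx M \o eps) i =
  fun w => \sum_l M i l * coordinate eps l w.
Proof. by apply/funext => w; rewrite /coordinate /= mxE. Qed.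

Lemma coordinate_mulmx_Lfun2 m n (M : 'M[R]_(n, m)) (eps : {RV P >-> 'cV[R]_m})
    (i : 'I_n) : finite_second_moments eps ->
  coordinate (mulmx M \o eps) i \in Lfun P 2%:E.
Proof. by move=> eps2; rewrite coordinate_mulmx Lfun_lincomb// ler1n. Qed.

Lemma orthogonal_row_mxE m n (u : 'cV[R]_m) (Gamma : 'M[R]_(m, n)) :
  orthogonal_mx (row_mx u Gamma) ->
  [/\ u^T *m u = 1%:M, u^T *m Gamma = 0 & Gamma^T *m u = 0].
Proof.
move=> [+ _]; rewrite tr_row_mx mul_col_row scalar_mx_block.
by move=> /eq_block_mx[].
Qed.

Lemma reflection_symmetric_expectation_mul m n (u : 'cV[R]_m)
    (Gamma : 'M[R]_(m, n)) (eps : {RV P >-> 'cV[R]_m}) (i : 'I_1) (j : 'I_n) :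
  orthogonal_mx (row_mx u Gamma) -> finite_second_moments eps ->
  reflection_symmetric u eps ->
  'E_P[(coordinate (mulmx u^T \o eps) i *
    coordinate (mulmx Gamma^T \o eps) j)%R]%E = 0%E.
Proof.
move=> /orthogonal_row_mxE[uu uG Gu] eps2 H0.
pose Q := reflection_mx u.
(* [Q] fixes [u] and negates its orthogonal complement, read here on rows. *)
have uQ : u^T *m Q = u^T.
  rewrite /Q /reflection_mx mulmxBr mulmx1 -scalemxAr mulmxA uu mul1mx.
  by rewrite scaler_nat mulr2n addrK.
have GQ : Gamma^T *m Q = - Gamma^T.
  rewrite /Q /reflection_mx mulmxBr mulmx1 -scalemxAr mulmxA Gu.
  by rewrite mul0mx scaler0 sub0r.
pose f (e : 'cV[R]_m) := (u^T *m e) i 0 * (Gamma^T *m e) j 0.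
have mf : measurable_fun setT f.
  apply: measurable_funM.
    apply: (measurableT_comp (@measurable_entry _ R 1 1 i 0)).
    exact: measurable_mulmx.
  apply: (measurableT_comp (@measurable_entry _ R n 1 j 0)).
  exact: measurable_mulmx.
have feps : f \o eps \in Lfun P 1.
  by apply: Lfun2_mul_Lfun1; exact: coordinate_mulmx_Lfun2.
have fQ : f \o (mulmx Q \o eps) = \- (f \o eps).
  apply/funext => w /=; rewrite /f !mulmxA uQ GQ mulNmx.
  by rewrite [X in _ * X]mxE mulrN.
apply: (eqN_expectation_eq0 feps); rewrite -fQ.
by apply: eq_law_expectation => //; rewrite fQ rpredN.
Qed.

Lemma reflection_symmetric_uncorrelated m n (u : 'cV[R]_m)
    (Gamma : 'M[R]_(m, n)) (eps : {RV P >-> 'cV[R]_m}) :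
  orthogonal_mx (row_mx u Gamma) -> finite_second_moments eps ->
  has_mean eps 0 -> reflection_symmetric u eps ->
  uncorrelated (mulmx u^T \o eps : {RV P >-> 'cV[R]_1})
    (mulmx Gamma^T \o eps : {RV P >-> 'cV[R]_n}).
Proof.
move=> orth eps2 mean0 H0 i j.
have Pfin : P setT \is a fin_num := fin_num_measure P _ measurableT.
have X2 := coordinate_mulmx_Lfun2 u^T i eps2.
have Y2 := coordinate_mulmx_Lfun2 Gamma^T j eps2.
rewrite covarianceE ?Lfun2_mul_Lfun1 ?(Lfun_subset12 Pfin)//.
rewrite (reflection_symmetric_expectation_mul _ _ orth eps2 H0).
(* The product of means vanishes through its second factor, a linear combination of the zero means
   of eps. *)
rewrite [X in (_ - _ * X)%E](_ : _ = 0%E) ?mule0 ?sube0 ?mxE//.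
rewrite coordinate_mulmx expectation_lincomb; last first.
  by move=> l; apply: (Lfun_subset12 Pfin); exact: eps2.
rewrite big1// => l _.
by rewrite mean0 (_ : (0 : 'cV[R]_m) l 0 = 0) ?mule0 ?mxE.
Qed.

Lemma normal_expectation k m (X : {RV P >-> 'cV[R]_m})
    (nu : probability 'cV[R]_k R) (A : 'M[R]_(m, k)) (b : 'cV[R]_m) (f : 'cV[R]_m -> R) :
  (forall B : set 'cV[R]_m, measurable B ->
    distribution P X B = pushforward nu (fun z => A *m z + b) B) ->
  measurable_fun setT f ->
  f \o X \in Lfun P 1 -> (fun z => f (A *m z + b)) \in Lfun nu 1 ->
  'E_P[f \o X]%E = 'E_nu[fun z => f (A *m z + b)%R]%E.
Proof.
move=> Xlaw mf fX fZ.
apply: (@eq_law_expectation _ _ _ _ _ _ _ P nu X (fun z => A *m z + b) f) => //.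
apply: measurable_fun_matrix => i j; under eq_fun do rewrite mxE.
apply: measurable_funD; last exact: measurable_cst.
exact: (measurableT_comp (@measurable_entry _ R m 1 i j) (measurable_mulmx A)).
Qed.

Lemma linear_standard_normal_Lfun2 k n (nu : probability 'cV[R]_k R)
    (M : 'M[R]_(n, k)) (i : 'I_n) : standard_normal_law nu ->
  (fun z => (M *m z) i 0) \in Lfun nu 2%:E.
Proof.
move=> nuN; rewrite (_ : (fun z => _) =
    (fun z : 'cV[R]_k => \sum_l M i l * z l 0)%R).
  by apply: Lfun_lincomb => [|l]; [rewrite ler1n|
    exact: standard_normal_coord_Lfun2].
by apply/funext => z; rewrite mxE.
Qed.

(** Since Z is centered, the mean of A Z + b is b. *)
Lemma normal_mean0_shift k m (eps : {RV P >-> 'cV[R]_m})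
    (nu : probability 'cV[R]_k R) (A : 'M[R]_(m, k)) (b : 'cV[R]_m) :
  finite_second_moments eps -> has_mean eps 0 -> standard_normal_law nu ->
  (forall B : set 'cV[R]_m, measurable B ->
    distribution P eps B = pushforward nu (fun z => A *m z + b) B) ->
  b = 0.
Proof.
move=> eps2 mean0 nuN law.
have Pfin : P setT \is a fin_num := fin_num_measure P _ measurableT.
have nufin : nu setT \is a fin_num := fin_num_measure nu _ measurableT.
apply/matrixP => i j; rewrite (ord1 j) mxE; apply: EFin_inj.
have Eeps : 'E_P[coordinate eps i]%E = 0%E by rewrite mean0 mxE.
have AzL1 : (fun z : 'cV[R]_k => (A *m z) i 0) \in Lfun nu 1.
  by apply: (Lfun_subset12 nufin); exact: linear_standard_normal_Lfun2.
have coordE : (fun z : 'cV[R]_k => (A *m z + b) i 0) =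
    (fun z => (A *m z) i 0) \+ cst (b i 0).
  by apply/funext => z; rewrite mxE.
rewrite -[RHS]Eeps.
rewrite (normal_expectation (f := fun e => e i 0) law)//.
- rewrite coordE expectationD ?Lfun_cst// expectation_cst.
  rewrite (_ : (fun z => _) = (fun z : 'cV[R]_k => \sum_l A i l * z l 0)%R).
    rewrite expectation_lincomb => [|l]; last exact: standard_normal_coord_Lfun1.
    by rewrite big1 ?add0e// => l _;
      rewrite standard_normal_expectation_coord ?mule0.
  by apply/funext => z; rewrite mxE.
- exact: measurable_entry.
- by apply: (Lfun_subset12 Pfin); exact: eps2.
- by rewrite coordE rpredD ?Lfun_cst.
Qed.

(** The mixed moment is computed twice: it is 0 by symmetry, and through A Z it is the inner product
    of row [j] of [Gamma^T *m A] with [u^T *m A], times the second moment, which can be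
    cancelled. *)
Lemma reflection_symmetric_normal_orthogonal k m n (u : 'cV[R]_m)
    (Gamma : 'M[R]_(m, n)) (eps : {RV P >-> 'cV[R]_m})
    (nu : probability 'cV[R]_k R) (A : 'M[R]_(m, k)) :
  orthogonal_mx (row_mx u Gamma) -> finite_second_moments eps ->
  reflection_symmetric u eps -> standard_normal_law nu ->
  (forall B : set 'cV[R]_m, measurable B ->
    distribution P eps B = pushforward nu (fun z => A *m z + 0) B) ->
  (Gamma^T *m A) *m (u^T *m A)^T = 0.
Proof.
move=> orth eps2 H0 nuN law.
apply/matrixP => j i; rewrite (ord1 i).
pose f (e : 'cV[R]_m) := (u^T *m e) 0 0 * (Gamma^T *m e) j 0.
have mf : measurable_fun setT f.
  by apply: measurable_funM;
    exact: (measurableT_comp (measurable_entry _ _) (measurable_mulmx _)).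
have feps : f \o eps \in Lfun P 1.
  by apply: Lfun2_mul_Lfun1; exact: coordinate_mulmx_Lfun2.
have fE : (fun z => f (A *m z + 0)) = fun z : 'cV[R]_k =>
    (\sum_l (u^T *m A)^T l 0 * z l 0) * (\sum_l (Gamma^T *m A) j l * z l 0).
  apply/funext => z; rewrite addr0 /f !mulmxA [(_ *m _) 0 0]mxE.
  rewrite [((_ *m A) *m _) j 0]mxE; congr (_ * _).
  by apply: eq_bigr => l _; rewrite [in RHS]mxE.
have f1 : (fun z => f (A *m z + 0)) \in Lfun nu 1.
  under eq_fun do rewrite addr0 /f !mulmxA.
  by apply: Lfun2_mul_Lfun1; exact: linear_standard_normal_Lfun2.
have := reflection_symmetric_expectation_mul 0 j orth eps2 H0.
rewrite -[X in 'E_P[X]%E]/(f \o eps) (normal_expectation law mf feps f1) fE.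
have := standard_normal_expectation_mul_linear nuN (u^T *m A)^T
  (row j (Gamma^T *m A))^T.
under eq_fun => z do under [X in _ * X]eq_bigr => l _ do
  rewrite [_^T _ _]mxE [row _ _ _ _]mxE.
move=> -> /eqP; rewrite mule_eq0 (negPf normal_second_moment_neq0) orbF.
rewrite eqe => /eqP uG0; rewrite mxE [RHS]mxE -[RHS]uG0.
by apply: eq_bigr => l _; rewrite mulrC; congr (_ * _); rewrite !mxE.
Qed.

Lemma reflection_symmetric_normal_independent m n (u : 'cV[R]_m)
    (Gamma : 'M[R]_(m, n)) (eps : {RV P >-> 'cV[R]_m}) :
  orthogonal_mx (row_mx u Gamma) -> finite_second_moments eps ->
  has_mean eps 0 -> reflection_symmetric u eps -> normal_vector eps ->
  independent_RV (mulmx u^T \o eps : {RV P >-> 'cV[R]_1})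
    (mulmx Gamma^T \o eps : {RV P >-> 'cV[R]_n}).
Proof.
move=> orth eps2 mean0 H0 [k [nu [A [b [nuN law]]]]].
have b0 := normal_mean0_shift eps2 mean0 nuN law; rewrite {}b0 in law.
have GAu := reflection_symmetric_normal_orthogonal orth eps2 H0 nuN law.
move=> B1 B2 mB1 mB2.
set U := mulmx u^T @^-1` B1; set V := mulmx Gamma^T @^-1` B2.
have mU : measurable U by exact: measurable_preimage_mulmx.
have mV : measurable V by exact: measurable_preimage_mulmx.
have lawE C : measurable C -> P (eps @^-1` C) = nu (mulmx A @^-1` C).
  move=> mC; rewrite -[LHS]/(distribution P eps C) law//.
  by congr (nu _); apply/seteqP; split => z /=; rewrite addr0.
rewrite -[LHS]/(P (eps @^-1` (U `&` V))).
rewrite -[RHS]/(P (eps @^-1` U) * P (eps @^-1` V))%E.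
rewrite (lawE _ mU) (lawE _ mV) (lawE _ (measurableI _ _ mU mV)).
have pre p (M : 'M[R]_(p, m)) (B : set 'cV[R]_p) :
    mulmx A @^-1` (mulmx M @^-1` B) = mulmx (M *m A) @^-1` B.
  by apply/seteqP; split => z /=; rewrite mulmxA.
(* The double transpose exhibits [u^T *m A] as [a^T] for the column [a] that [Gamma^T *m A]
   annihilates. *)
rewrite preimage_setI /U /V !pre -[u^T *m A]trmxK.
exact: standard_normal_orthogonal_indep.
Qed.

End reflection_symmetry.

Theorem lemma3 (R : realType) (d : measure_display) (T : measurableType d)
    (P : probability T R) (m : nat) (hm : (2 <= m)%N)
    (u : 'cV[R]_m) (hu : euclidean_norm u = 1)
    (Gamma : 'M[R]_(m, m.-1)) (hGamma : orthogonal_mx (row_mx u Gamma))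
    (Omega : 'M[R]_m) (eps : {RV P >-> 'cV[R]_m})
    (hmoments : finite_second_moments eps)
    (hmean : has_mean eps 0) (hvar : has_variance eps Omega)
    (H0 : reflection_symmetric u eps) :
  let X : {RV P >-> 'cV[R]_1} := mulmx u^T \o eps in
  let Y : {RV P >-> 'cV[R]_(m.-1)} := mulmx Gamma^T \o eps in
  uncorrelated X Y /\ (normal_vector eps -> independent_RV X Y).
Proof.
move=> X Y; split; first exact: reflection_symmetric_uncorrelated.
exact: reflection_symmetric_normal_independent.
Qed.
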